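(* Let $R$ be a unital $QB$-ring. Then $pRp$ is a $QB$-corner for every non-zero idempotent $p\in R$; and for any pair of idempotents $p,q\in R$ such that $1-p\sim1-q$, either $p\perp q$ or else $pRq$ is a $QB$-corner.
   Context: Rings are associative. For elements $s,t$ of a unital ring $R$ write $s\perp t$ if $sRt=0$ and $tRs=0$. An element $w\in R$ is quasi-invertible, $w\in R_q^{-1}$, if there exist $a,b\in R$ with $(1-wa)\perp(1-bw)$. $R$ is a $QB$-ring if whenever $xa+b=1$ in $R$ there is $y\in R$ with $a+yb\in R_q^{-1}$. Idempotents $e,f$ are (Murray-von Neumann) equivalent, $e\sim f$, if $e=uv$ and $f=vu$ for some $u,v\in R$. Let $p,q$ be idempotents with $pRq\ne0$. An element $x\in pRq$ is in $(pRq)_q^{-1}$ if there exist $a,b\in qRp$ with $(p-xa)\perp(q-bx)$. $\operatorname{cl}^{\sim}((pRq)_q^{-1})$ is the set of $a\in pRq$ such that whenever $xa+b=q$ for some $x\in qRp$, $b\in qRq$, there is $y\in pRq$ with $a+yb\in(pRq)_q^{-1}$. $\operatorname{cr}^{\sim}((pRq)_q^{-1})$ is the set of $a\in pRq$ such that whenever $ax+b=p$ for some $x\in qRp$, $b\in pRp$, there is $y\in pRq$ with $a+by\in(pRq)_q^{-1}$. $pRq$ is a $QB$-corner if $pRq\neq0$ and $\operatorname{cl}^{\sim}((pRq)_q^{-1})=pRq=\operatorname{cr}^{\sim}((pRq)_q^{-1})$. (For $p=q$, $pRp$ is a $QB$-corner if and only if it is a $QB$-ring with unit $p$.) *)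

(* Defs.v *)
From mathcomp Require Import all_boot all_algebra.
From mathcomp Require Import boolp classical_sets.

Set Implicit Arguments.
Unset Strict Implicit.
Unset Printing Implicit Defensive.

Import GRing.Theory.

Local Open Scope classical_set_scope.
Local Open Scope ring_scope.

(* Unital, associative, not necessarily commutative rings are [pzRingType]s;
   the zero ring is allowed. *)

Definition idem (R : pzRingType) (p : R) : Prop := p * p = p.

(* Murray-von Neumann equivalence *)
Definition mvn_equiv (R : pzRingType) (e f : R) : Prop :=
  exists u v : R, e = u * v /\ f = v * u.

(* s _|_ t, i.e. sRt = 0 and tRs = 0 *)
Definition perp (R : pzRingType) (s t : R) : Prop :=
  (forall r : R, s * r * t = 0) /\ (forall r : R, t * r * s = 0).

Definition quasi_invertible (R : pzRingType) : set R :=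
  [set w | exists a b : R, perp (1 - w * a) (1 - b * w)].
Arguments quasi_invertible : clear implicits.

Definition QB_ring (R : pzRingType) : Prop :=
  forall x a b : R, x * a + b = 1 ->
    exists y : R, quasi_invertible R (a + y * b).
Arguments QB_ring : clear implicits.

(* The corner pRq. In the definitions below, p and q are meant to be
   idempotents, so that p and q are the units of pRp and qRq. *)
Definition corner (R : pzRingType) (p q : R) : set R :=
  [set p * r * q | r in [set: R]].

(* (pRq)_q^{-1} *)
Definition corner_qinv (R : pzRingType) (p q : R) : set R :=
  [set x | corner p q x /\
    exists a b : R, [/\ corner q p a, corner q p b &
      perp (p - x * a) (q - b * x)]].

(* cl^~((pRq)_q^{-1}) *)
Definition cl_qinv (R : pzRingType) (p q : R) : set R :=
  [set a | corner p q a /\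
    forall x b : R, corner q p x -> corner q q b -> x * a + b = q ->
      exists2 y : R, corner p q y & corner_qinv p q (a + y * b)].

(* cr^~((pRq)_q^{-1}) *)
Definition cr_qinv (R : pzRingType) (p q : R) : set R :=
  [set a | corner p q a /\
    forall x b : R, corner q p x -> corner p p b -> a * x + b = p ->
      exists2 y : R, corner p q y & corner_qinv p q (a + b * y)].

Definition QB_corner (R : pzRingType) (p q : R) : Prop :=
  [/\ corner p q <> [set 0],
      cl_qinv p q = corner p q &
      cr_qinv p q = corner p q].

(* Main.v *)
Require Import Defs.
From mathcomp Require Import all_boot all_algebra.
From mathcomp Require Import boolp classical_sets.
Set Implicit Arguments.
Unset Strict Implicit.
Unset Printing Implicit Defensive.
Import GRing.Theory.
Local Open Scope ring_scope.

(** If [1 - p = u v] and [1 - q = v u] with [u] in [(1-p)R(1-q)], an equation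
    [x a + b = q] in the corner lifts to [(x + v) (a + u) + b = 1] in [R].  The
    QB-property makes [a + u + y b] quasi-invertible; multiplying by the unit
    [1 - v y b] removes the off-diagonal part [(1-p) y b], and a block-diagonal
    quasi-invertible [w + u] has [w] quasi-invertible in [pRq].  Equations
    [a x + b = p] are handled in the same way, because the QB-property is
    left-right symmetric.  If [pRq = 0], then [0] is quasi-invertible in [pRq],
    which says exactly that [p] and [q] are orthogonal. *)

(** The inner factors are absorbed into the arbitrary middle element [r]. Later quasi-invertibility
    proofs thus reduce to exhibiting both defects as multiples of orthogonal ones. *)
Lemma perp_mul (R : pzRingType) (s t a b c d : R) :
  perp s t -> perp (a * s * b) (c * t * d).
Proof.
case=> st ts; split=> r.
  have -> : a * s * b * r * (c * t * d) = a * (s * (b * r * c) * t) * d.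
    by rewrite !mulrA.
  by rewrite st mulr0 mul0r.
have -> : c * t * d * r * (a * s * b) = c * (t * (d * r * a) * s) * b.
  by rewrite !mulrA.
by rewrite ts mulr0 mul0r.
Qed.

Lemma perp_sym (R : pzRingType) (s t : R) : perp s t -> perp t s.
Proof. by case. Qed.

(** The two one-sided witnesses merge because [(1 - w * a) * (1 - w * b)] and
    [(1 - a * w) * (1 - b * w)] are the defects of the single element [a + b - a * w * b]. *)
Lemma quasi_invertible_inv (R : pzRingType) (w : R) :
  quasi_invertible R w -> exists v : R, perp (1 - w * v) (1 - v * w).
Proof.
case=> a [b ab]; exists (a + b - a * w * b).
have -> : 1 - w * (a + b - a * w * b) = 1 * (1 - w * a) * (1 - w * b).
  rewrite mul1r [RHS]mulrBr mulr1 mulrBl mul1r mulrBr mulrDr !mulrA.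
  by rewrite -addrA opprD addrA.
have -> : 1 - (a + b - a * w * b) * w = (1 - a * w) * (1 - b * w) * 1.
  rewrite mulr1 [RHS]mulrBr mulr1 !mulrBl mul1r mulrDl !mulrA.
  by rewrite -addrA opprD addrA.
exact: perp_mul.
Qed.

Lemma quasi_invertible_mulr_unit (R : pzRingType) (w c c' : R) :
  c * c' = 1 -> c' * c = 1 -> quasi_invertible R w ->
  quasi_invertible R (w * c).
Proof.
move=> cc' c'c [a [b ab]]; exists (c' * a), (c' * b).
have -> : 1 - w * c * (c' * a) = 1 * (1 - w * a) * 1.
  by rewrite mul1r mulr1 mulrA -(mulrA w) cc' mulr1.
have -> : 1 - c' * b * (w * c) = c' * (1 - b * w) * c.
  by rewrite mulrBr mulrBl mulr1 c'c !mulrA.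
exact: perp_mul.
Qed.

Lemma quasi_invertible_mull_unit (R : pzRingType) (w c c' : R) :
  c * c' = 1 -> c' * c = 1 -> quasi_invertible R w ->
  quasi_invertible R (c * w).
Proof.
move=> cc' c'c [a [b ab]]; exists (a * c'), (b * c').
have -> : 1 - c * w * (a * c') = c * (1 - w * a) * c'.
  by rewrite mulrBr mulrBl mulr1 cc' !mulrA.
have -> : 1 - b * c' * (c * w) = 1 * (1 - b * w) * 1.
  by rewrite mul1r mulr1 mulrA -(mulrA b) c'c mulr1.
exact: perp_mul.
Qed.

Lemma square_zero_unit (R : pzRingType) (n : R) :
  n * n = 0 -> (1 - n) * (1 + n) = 1 /\ (1 + n) * (1 - n) = 1.
Proof.
move=> nn; split.
  by rewrite mulrBl mul1r mulrDr mulr1 nn addr0 addrK.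
by rewrite mulrDl mul1r mulrBr mulr1 nn subr0 subrK.
Qed.

(* With [u = x + y b] quasi-invertible and [v] a quasi-inverse of it, a
   quasi-inverse of [w = a + b v (1 - y a)] is [s = x + (1 - x a) y]: one has
   [1 - w s = b (1 - v u) (1 - a y)] and
   [1 - s w = (1 - x a) (1 - u v) (1 - y a)]. *)
Lemma QB_ring_right (R : pzRingType) : QB_ring R ->
  forall a x b : R, a * x + b = 1 ->
    exists y : R, quasi_invertible R (a + b * y).
Proof.
move=> hR a x b axb; have [y /quasi_invertible_inv[v uv]] := hR _ _ _ axb.
set u := x + y * b in uv.
pose s := x + (1 - x * a) * y.
exists (v * (1 - y * a)), s, s.
have ax : a * x = 1 - b by rewrite -axb addrK.
set w := a + b * (v * (1 - y * a)).
have wx : w * x = 1 - b * (1 - v * u) - b * v * y.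
  have e : (1 - y * a) * x = u - y.
    by rewrite mulrBl mul1r -mulrA ax mulrBr mulr1 opprB addrA addrAC.
  rewrite mulrDl ax -!mulrA e !mulrBr mulr1 !mulrA opprB.
  by rewrite !addrA [1 + _ - b]addrAC.
have wy : w * y = a * y + b * v * y * (1 - a * y).
  by rewrite mulrDl !mulrBr !mulrBl !mulr1 !mulrA.
(* As [b = 1 - a * x], one has [x * b = (1 - x * a) * x]. *)
have sb : s * b = (1 - x * a) * u.
  rewrite mulrDl [(1 - x * a) * u]mulrDr !mulrA; congr (_ + _).
  by rewrite mulrBl mul1r -mulrA ax mulrBr mulr1 subKr.
have -> : 1 - w * s = b * (1 - v * u) * (1 - a * y).
  have -> : w * s = w * x * (1 - a * y) + w * y.
    by rewrite mulrDr mulrBl mul1r !mulrBr mulr1 !mulrA addrA addrAC.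
  rewrite wx wy addrCA -mulrDl subrK mulrBl mul1r.
  by rewrite [1 - a * y - _]addrC addrCA subrKC opprD opprK subrKC.
have -> : 1 - s * w = (1 - x * a) * (1 - u * v) * (1 - y * a).
  have -> : s * w = s * a + (1 - x * a) * (u * v) * (1 - y * a).
    by rewrite mulrDr !mulrA sb.
  have -> : s * a = 1 - (1 - x * a) * (1 - y * a).
    by rewrite mulrBr mulr1 mulrA /s mulrDl opprB addrCA subKr addrC.
  by rewrite [(1 - x * a) * (1 - u * v)]mulrBr mulr1 [in RHS]mulrBl opprD
    opprB addrA addrCA subrr addr0.
(* The defects of [u] have traded sides: [1 - v * u] now sits inside [1 - w * s]. *)
exact/perp_mul/perp_sym.
Qed.

Lemma cornerP (R : pzRingType) (p q x : R) : idem p -> idem q ->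
  corner p q x <-> p * x = x /\ x * q = x.
Proof.
move=> pp qq; split=> [[r _ <-]|[px xq]].
  by rewrite -!mulrA qq !mulrA pp.
by exists x => //; rewrite px xq.
Qed.

(** Cutting [u] and [v] down to the corners keeps both products, since [u * f = u * v * u = e * u]
    and likewise for [v]. *)
Lemma mvn_equiv_corner (R : pzRingType) (e f : R) :
  idem e -> idem f -> mvn_equiv e f ->
  exists u v : R, [/\ e = u * v, f = v * u, corner e f u & corner f e v].
Proof.
move=> ee ff [u [v [eE fE]]]; exists (e * u * f), (f * v * e).
have uf : u * f = e * u by rewrite fE eE mulrA.
have ve : v * e = f * v by rewrite fE eE mulrA.
have eef : e * u * f = e * u by rewrite -mulrA uf mulrA ee.
have fve : f * v * e = f * v by rewrite -mulrA ve mulrA ff.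
split; [| |by exists u|by exists v]; rewrite eef fve.
  by rewrite -ve mulrA -[e * u * v]mulrA -eE !ee.
by rewrite -uf mulrA -[f * v * u]mulrA -fE !ff.
Qed.

(** Compress the witnesses to [qRp]: as [p * (w + u) = w = (w + u) * q], the new defects are the old
    ones cut down by [p] and by [q]. *)
Lemma corner_qinv_block (R : pzRingType) (p q w u : R) :
  idem p -> idem q -> corner p q w -> p * u = 0 -> u * q = 0 ->
  quasi_invertible R (w + u) -> corner_qinv p q w.
Proof.
move=> pp qq cw pu uq [a [b ab]]; split=> //.
have [pw wq] := (cornerP w pp qq).1 cw.
exists (q * a * p), (q * b * p); split; [by exists a|by exists b|].
have -> : p - w * (q * a * p) = p * (1 - (w + u) * a) * p.
  by rewrite mulrBr mulrBl mulr1 pp !mulrA (mulrDr p) pw pu addr0 wq.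
have -> : q - q * b * p * w = q * (1 - b * (w + u)) * q.
  by rewrite mulrBr mulrBl mulr1 qq -!mulrA (mulrDl w) wq uq addr0 pw.
exact: perp_mul.
Qed.

Section Corner.

Variables (R : pzRingType) (p q u v : R).
Hypotheses (hR : QB_ring R) (pp : idem p) (qq : idem q).
Hypotheses (uvE : 1 - p = u * v) (vuE : 1 - q = v * u).
Hypotheses (pu : p * u = 0) (uq : u * q = 0) (qv : q * v = 0) (vp : v * p = 0).

Lemma cl_qinv_full : cl_qinv p q = corner p q.
Proof.
apply/seteqP; split=> [a []//|a ca]; split=> // x b cx cb xab.
have [pa aq] := (cornerP a pp qq).1 ca.
have [qx xp] := (cornerP x qq pp).1 cx.
have [qb bq] := (cornerP b qq qq).1 cb.
have xu : x * u = 0 by rewrite -xp -mulrA pu mulr0.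
have va : v * a = 0 by rewrite -pa mulrA vp mul0r.
have av : a * v = 0 by rewrite -aq -mulrA qv mulr0.
have bv : b * v = 0 by rewrite -bq -mulrA qv mulr0.
have XA : (x + v) * (a + u) + b = 1.
  by rewrite mulrDl !mulrDr xu va addr0 add0r addrAC xab -vuE subrKC.
have [y wq] := hR XA; exists (p * y * q); first by exists y.
apply: (@corner_qinv_block _ _ _ _ u) => //.
  apply/cornerP => //; split; last by rewrite mulrDl aq -!mulrA bq.
  by rewrite mulrDr pa !mulrA pp.
have nn : v * y * b * (v * y * b) = 0.
  by rewrite !mulrA -(mulrA (v * y)) bv mulr0 !mul0r.
have [c1 c2] := square_zero_unit nn.
(* With [a * v = b * v = 0] and [u * v = 1 - p], the unit subtracts exactly [(1 - p) * y * b]. *)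
have -> : a + p * y * q * b + u = (a + u + y * b) * (1 - v * y * b).
  rewrite mulrBr mulr1 !mulrDl !mulrA av -!(mulrA y b) bv mulr0 !mul0r add0r
    addr0 -uvE !mulrBl mul1r -(mulrA _ q) qb opprB.
  by rewrite -[RHS]addrA subrKC addrAC.
exact: quasi_invertible_mulr_unit c1 c2 wq.
Qed.

Lemma cr_qinv_full : cr_qinv p q = corner p q.
Proof.
apply/seteqP; split=> [a []//|a ca]; split=> // x b cx cb axb.
have [pa aq] := (cornerP a pp qq).1 ca.
have [qx xp] := (cornerP x qq pp).1 cx.
have [pb bp] := (cornerP b pp pp).1 cb.
have ux : u * x = 0 by rewrite -qx mulrA uq mul0r.
have va : v * a = 0 by rewrite -pa mulrA vp mul0r.
have av : a * v = 0 by rewrite -aq -mulrA qv mulr0.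
have vb : v * b = 0 by rewrite -pb mulrA vp mul0r.
have AX : (a + u) * (x + v) + b = 1.
  by rewrite mulrDl !mulrDr ux av addr0 add0r addrAC axb -uvE subrKC.
have [y wq] := QB_ring_right hR AX; exists (p * y * q); first by exists y.
apply: (@corner_qinv_block _ _ _ _ u) => //.
  apply/cornerP => //; split; first by rewrite mulrDr pa !mulrA pb.
  by rewrite mulrDl aq -!mulrA qq.
have nn : b * y * v * (b * y * v) = 0.
  by rewrite !mulrA -(mulrA (b * y)) vb mulr0 !mul0r.
have [c1 c2] := square_zero_unit nn.
(* Mirror image: [v * a = v * b = 0] and [v * u = 1 - q], so [b * y * (1 - q)] is removed. *)
have -> : a + b * (p * y * q) + u = (1 - b * y * v) * (a + u + b * y).
  rewrite mulrBl mul1r !mulrDr -!(mulrA (b * y)) va -vuE !(mulrA v) vb mul0r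
    mulr0 add0r addr0 mulrBr mulr1 !mulrA bp opprB.
  by rewrite -[RHS]addrA subrKC addrAC.
exact: quasi_invertible_mull_unit c1 c2 wq.
Qed.

End Corner.

Lemma idem_compl (R : pzRingType) (p : R) : idem p -> idem (1 - p).
Proof. by move=> pp; rewrite /idem mulrBr mulr1 mulrBl mul1r pp subrr subr0. Qed.

Lemma perp_or_QB_corner (R : pzRingType) (p q : R) : QB_ring R ->
  idem p -> idem q -> mvn_equiv (1 - p) (1 - q) -> perp p q \/ QB_corner p q.
Proof.
move=> hR pp qq /(mvn_equiv_corner (idem_compl pp) (idem_compl qq)).
move=> [u [v [uvE vuE [r _ rE] [t _ tE]]]].
have cp : p * (1 - p) = 0 by rewrite mulrBr mulr1 pp subrr.
have pc : (1 - p) * p = 0 by rewrite mulrBl mul1r pp subrr.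
have cq : q * (1 - q) = 0 by rewrite mulrBr mulr1 qq subrr.
have qc : (1 - q) * q = 0 by rewrite mulrBl mul1r qq subrr.
have pu : p * u = 0 by rewrite -rE !mulrA cp !mul0r.
have uq : u * q = 0 by rewrite -rE -!mulrA qc !mulr0.
have qv : q * v = 0 by rewrite -tE !mulrA cq !mul0r.
have vp : v * p = 0 by rewrite -tE -!mulrA pc !mulr0.
have clE := cl_qinv_full hR pp qq uvE vuE pu uq qv vp.
have crE := cr_qinv_full hR pp qq uvE vuE pu uq qv vp.
have [pq0|pqN0] := EM (corner p q = [set 0]%classic); last by right.
left; have /= : cl_qinv p q 0 by rewrite clE pq0.
(* The equation [0 * 0 + q = q] produces a quasi-invertible element of the zero corner; it is [0],
   with defects [p] and [q]. *)
move=> [_ /(_ 0 q)[]]; first by exists 0; rewrite // mulr0 mul0r.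
- by exists q; rewrite // !qq.
- by rewrite mul0r add0r.
move=> y _ [cy [a [b [_ _]]]].
by move: cy; rewrite pq0 => ->; rewrite mul0r mulr0 !subr0.
Qed.

Theorem corollary5p8 (R : pzRingType) (hR : QB_ring R) :
  (forall p : R, idem p -> p <> 0 -> QB_corner p p) /\
  (forall p q : R, idem p -> idem q -> mvn_equiv (1 - p) (1 - q) ->
     perp p q \/ QB_corner p q).
Proof.
split=> [p pp p0|p q pp qq]; last exact: perp_or_QB_corner.
have [||//] := perp_or_QB_corner hR pp pp.
  by exists (1 - p), (1 - p); rewrite (idem_compl pp).
(* [perp p p] would give [p = p * p * p = 0]. *)
by case=> /(_ p); rewrite !pp.
Qed.
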